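(* Let $\mathcal{T}$ be a mesh of a bounded domain $\Omega\subset\mathbb{R}^d$ ($d=2,3$), let $f\in L^2(\Omega)$, and let $P^0(\mathcal{T})$, $\tilde X_h$, $[\cdot,\cdot]_h$, $\mathrm{div}_h$, $\mathcal{F}_h$, $\pi_2$ be the mimetic finite difference (MFD) objects defined in the context. Let $P_h:P^0(\mathcal{T})\times\tilde X_h\to P^0(\mathcal{T})\times\tilde X_h$, $$P_h(u_h,\mathbf{p}_h)=\left(-\mathrm{div}_h\,\mathbf{p}_h-\pi_2f,\ \ \mathbf{p}_h-\mathcal{F}_hu_h\right),$$ be the MFD discrete differential embedding of the mixed Poisson problem, and let $\mathcal{H}_h:P^0(\mathcal{T})\times\tilde X_h\to\mathbb{R}$, $$\mathcal{H}_h(u_h,\mathbf{p}_h)=[\mathbf{p}_h,\mathcal{F}_hu_h]_h-\frac12[\mathbf{p}_h,\mathbf{p}_h]_h-(u_h,\pi_2f),$$ be the discrete Hamiltonian. Then the discrete differential formulation (i) find $(u_h,\mathbf{p}_h)\in P^0(\mathcal{T})\times\tilde X_h$ such that $P_h(u_h,\mathbf{p}_h)=0$ and the discrete variational formulation (ii) find $(u_h,\mathbf{p}_h)\in P^0(\mathcal{T})\times\tilde X_h$ such that $D\mathcal{H}_h(u_h,\mathbf{p}_h)(v_h,\mathbf{q}_h)=0$ for all $(v_h,\mathbf{q}_h)\in P^0(\mathcal{T})\times\tilde X_h$ are equivalent (they have the same solutions). Hence the MFD discretisation of the mixed Poisson problem is coherent.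
   Context: Setting: the mixed Poisson problem $-\mathrm{div}\,\mathbf{p}=f$, $\nabla u=\mathbf{p}$ in $\Omega$, with $u=0$ on $\partial\Omega$. Its (primal) Hamiltonian functional is $\mathcal{H}(u,\mathbf{p})=\int_\Omega\mathbf{p}\cdot\nabla u\,dx-\frac12\int_\Omega\mathbf{p}\cdot\mathbf{p}\,dx-\int_\Omega fu\,dx$. Mesh. A cell is a non-empty open polygonal/polyhedral subset of $\mathbb{R}^d$. A mesh $\mathcal{T}$ of $\Omega$ is a (finite) collection of cells with $\bigcup_{K\in\mathcal{T}}\overline{K}=\overline{\Omega}$ and, for $K_1,K_2\in\mathcal{T}$, either $K_1\cap K_2=\emptyset$ or $K_1=K_2$. The boundary faces $\mathcal{E}_0$ are the faces (edges if $d=2$) $e$ of cells $K\in\mathcal{T}$ with $e\subset\partial\Omega$; they satisfy $\partial\Omega=\bigcup_{e\in\mathcal{E}_0}e$, and for each $e\in\mathcal{E}_0$ there is a unique $K\in\mathcal{T}$ with $e\subset\overline{K}\cap\partial\Omega$. The internal faces $\mathcal{E}_i$ are the sets $e=\overline{K_1}\cap\overline{K_2}$, $K_1\ne K_2$ in $\mathcal{T}$, with non-zero $(d-1)$-dimensional measure; the pair $K_1,K_2$ is unique and one writes $e=K_1|K_2$. The face set is $\mathcal{E}=\mathcal{E}_0\cup\mathcal{E}_i$; it satisfies $\bigcup_{e\in\mathcal{E}}e=\bigcup_{K\in\mathcal{T}}\partial K$, and two distinct faces overlap in a set that is empty or of zero $(d-1)$-dimensional measure. Here $|K|$ and $|e|$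 are the $d$-dimensional measure of $K$ and the $(d-1)$-dimensional measure of $e$. Discrete spaces. $P^0(\mathcal{T})\subset L^2(\Omega)$ is the space of functions that are constant on each cell, identified with $\mathbb{R}^{\#\mathcal{T}}$ and equipped with the $L^2(\Omega)$ scalar product $(u,v)=\int_\Omega uv\,dx$. $\tilde X_h$ is the space of families of real numbers $\mathbf{p}=(p_{K,e})$, indexed by the pairs $K\in\mathcal{T}$, $e\in\mathcal{E}$ with $e\subset\partial K$, such that $p_{K_1,e}+p_{K_2,e}=0$ whenever $e=K_1|K_2$. For $K\in\mathcal{T}$, $\tilde X_h^K$ is the restriction of $\tilde X_h$ to $K$ (the families $(p_{K,e})_{e\subset\partial K}$). Projection: $\pi_2:L^2(\Omega)\to P^0(\mathcal{T})$, $\pi_2f=(f_K)_{K\in\mathcal{T}}$ with $f_K=\frac1{|K|}\int_Kf\,dx$. Discrete divergence: $\mathrm{div}_h:\tilde X_h\to P^0(\mathcal{T})$, $\mathrm{div}_h\,\mathbf{p}=(\mathrm{div}_K\,\mathbf{p})_{K\in\mathcal{T}}$ with $$\mathrm{div}_K\,\mathbf{p}=\frac1{|K|}\sum_{e\in\mathcal{E},\,e\subset\partial K}p_{K,e}\,|e|.$$ Scalar product on $\tilde X_h$: it is assumed that a scalar product $[\cdot,\cdot]_K$ is given on each $\tilde X_h^K$, $K\in\mathcal{T}$, and $$[\mathbf{p}_h,\mathbf{q}_h]_h=\sum_{K\in\mathcal{T}}[\mathbf{p}_h,\mathbf{q}_h]_K,\qquad \mathbf{p}_h,\mathbf{q}_h\in\tilde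 X_h$$ (each term evaluated on the restrictions to $K$). Discrete flux operator: $\mathcal{F}_h=-\mathrm{div}_h^\star:P^0(\mathcal{T})\to\tilde X_h$ is minus the adjoint of $\mathrm{div}_h$, i.e. the unique linear operator with $$[\mathbf{p}_h,\mathcal{F}_hu_h]_h=-(\mathrm{div}_h\,\mathbf{p}_h,u_h)\quad\text{for all }u_h\in P^0(\mathcal{T}),\ \mathbf{p}_h\in\tilde X_h.$$ The differential is $D\mathcal{H}_h(u,\mathbf{p})(v,\mathbf{q})=\lim_{\epsilon\to0}\frac{\mathcal{H}_h(u+\epsilon v,\mathbf{p}+\epsilon\mathbf{q})-\mathcal{H}_h(u,\mathbf{p})}{\epsilon}$. Coherence: a discretisation of a Hamiltonian system (discrete differential embedding $P_h$) is called coherent if its solutions are exactly the extremals (points where the differential vanishes in all discrete directions of variation) of a discrete Hamiltonian functional $\mathcal{H}_h$ that is a discrete variational embedding (discretisation) of $\mathcal{H}$. *)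

(* Defs.v *)
From HB Require Import structures.
From mathcomp Require Import all_boot all_order all_algebra.
From mathcomp Require Import finmap.
From mathcomp Require Import all_classical all_reals all_analysis.

Set Implicit Arguments.
Unset Strict Implicit.
Unset Printing Implicit Defensive.
Import Order.TTheory GRing.Theory Num.Theory.
Import numFieldNormedType.Exports.
Local Open Scope classical_set_scope.
Local Open Scope ring_scope.

(* Row vectors carry the sigma-algebra generated by the coordinates, i.e. the
   Borel sigma-algebra of R^n. *)
Definition rV_display : measure_display. Proof. exact. Qed.

Section rV_measurable.
Context {R : realType} (n : nat).

Let coords (i : 'I_n) (x : 'rV[R]_n) : R := x 0 i.

Let rV_set0 : g_sigma_preimage coords set0.
Proof. exact: sigma_algebra0. Qed.

Let rV_setC A : g_sigma_preimage coords A -> g_sigma_preimage coords (~` A).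
Proof. exact: sigma_algebraC. Qed.

Let rV_bigcup (F : _^nat) : (forall i, g_sigma_preimage coords (F i)) ->
  g_sigma_preimage coords (\bigcup_i (F i)).
Proof. exact: sigma_algebra_bigcup. Qed.

HB.instance Definition _ := @isMeasurable.Build rV_display
  'rV[R]_n (g_sigma_preimage coords) rV_set0 rV_setC rV_bigcup.

Lemma measurable_coord (i : 'I_n) :
  measurable_fun [set: 'rV[R]_n] (fun x : 'rV[R]_n => x 0 i).
Proof.
move=> _ Y mY; rewrite setTI; apply: sub_sigma_algebra => /=.
rewrite -bigcup_seq/=; exists i => /=; first by rewrite mem_index_enum.
by exists Y => //; rewrite setTI.
Qed.

Lemma measurable_fun_rV d (T : measurableType d) (f : T -> 'rV[R]_n) :
  (forall i, measurable_fun [set: T] (fun x => f x 0 i)) ->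
  measurable_fun [set: T] f.
Proof.
move=> mf; have fS : g_sigma_preimage (fun i => coords i \o f) `<=` measurable.
  apply: smallest_sub; first exact: sigma_algebra_measurable.
  rewrite -bigcup_seq/=; apply: bigcup_sub => i Ii.
  by move=> A [B mB <-]; exact: mf.
by move: fS; rewrite g_sigma_preimage_comp => fS _ A mA; apply: fS; exists A.
Qed.

End rV_measurable.

Lemma sigma_finite_product d1 d2 (T1 : measurableType d1)
    (T2 : measurableType d2) (R : realType)
    (m1 : {sigma_finite_measure set T1 -> \bar R})
    (m2 : {sigma_finite_measure set T2 -> \bar R}) :
  sigma_finite setT (m1 \x m2)%E.
Proof.
have /sigma_finiteP[F [TF ndF Foo]] := sigma_finiteT m1.
have /sigma_finiteP[G [TG ndG Goo]] := sigma_finiteT m2.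
exists (fun n => F n `*` G n).
  rewrite -setXTT TF TG predeqE => -[x y]; split.
    move=> [/= [n _ Fnx] [k _ Gky]]; exists (maxn n k) => //; split.
    - by move: x Fnx; exact/subsetPset/ndF/leq_maxl.
    - by move: y Gky; exact/subsetPset/ndG/leq_maxr.
  by move=> [n _ []/= ? ?]; split; exists n.
move=> k; have [? ?] := Foo k; have [? ?] := Goo k.
split; first exact: measurableX.
by rewrite product_measure1E// lte_mul_pinfty// ge0_fin_numE.
Qed.

Section lebesgue_step.
Context {R : realType} (n : nat).

Definition rV_cons (z : R * 'rV[R]_n) : 'rV[R]_n.+1 :=
  \row_(j < n.+1) if unlift ord0 j is Some k then z.2 0 k else z.1.

Lemma measurable_rV_cons : measurable_fun [set: R * 'rV[R]_n] rV_cons.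
Proof.
apply: measurable_fun_rV => i; rewrite /rV_cons.
under eq_fun do rewrite mxE.
case: unliftP => [k _|_].
  apply: (measurableT_comp (measurable_coord k)); exact: measurable_snd.
exact: measurable_fst.
Qed.

Let head_tail (v : 'rV[R]_n.+1) : R * 'rV[R]_n :=
  (v 0 ord0, \row_j v 0 (lift ord0 j)).

Let measurable_head_tail : measurable_fun [set: 'rV[R]_n.+1] head_tail.
Proof.
apply/measurable_fun_pairP; split; first exact: measurable_coord.
apply: measurable_fun_rV => i /=.
under eq_fun do rewrite mxE.
exact: measurable_coord.
Qed.

Let rV_consK : cancel rV_cons head_tail.
Proof.
case=> a v; rewrite /head_tail /rV_cons mxE unlift_none; congr pair.
by apply/rowP => j; rewrite !mxE liftK.
Qed.

Variable mu : {sigma_finite_measure set 'rV[R]_n -> \bar R}.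

Definition lebesgue_rV_succ : set 'rV[R]_n.+1 -> \bar R :=
  pushforward ((@lebesgue_measure R) \x mu)%E rV_cons.

Let lebesgue_rV_succ0 : lebesgue_rV_succ set0 = 0%E.
Proof. by rewrite /lebesgue_rV_succ /pushforward preimage_set0 measure0. Qed.

Let lebesgue_rV_succ_ge0 A : (0 <= lebesgue_rV_succ A)%E.
Proof. by apply: measure_ge0; exact: measurable_rV_cons. Qed.

Let lebesgue_rV_succ_sigma_additive : semi_sigma_additive lebesgue_rV_succ.
Proof.
have mpre A : measurable A -> measurable (rV_cons @^-1` A).
  by move=> mA; rewrite -[X in measurable X]setTI; exact: measurable_rV_cons.
move=> F mF tF mUF; rewrite /lebesgue_rV_succ /pushforward preimage_bigcup.
apply: measure_semi_sigma_additive.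
- by move=> k; exact: mpre.
- apply/trivIsetP => /= i j _ _ ij; rewrite -preimage_setI.
  by move/trivIsetP : tF => /(_ _ _ _ _ ij) ->//; rewrite preimage_set0.
- by rewrite -preimage_bigcup; exact: mpre.
Qed.

HB.instance Definition _ := isMeasure.Build _ _ _ lebesgue_rV_succ
  lebesgue_rV_succ0 lebesgue_rV_succ_ge0 lebesgue_rV_succ_sigma_additive.

Let sigma_finite_lebesgue_rV_succ : sigma_finite setT lebesgue_rV_succ.
Proof.
have [F FT mF] := sigma_finite_product (@lebesgue_measure R) mu.
exists (fun i => head_tail @^-1` F i).
  by rewrite -preimage_bigcup -FT preimage_setT.
move=> i; have [mFi Fi_fin] := mF i; split.
  by rewrite -[X in measurable X]setTI; exact: measurable_head_tail.
rewrite /lebesgue_rV_succ /pushforward -comp_preimage.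
by rewrite (_ : _ \o _ = id) //; apply/funext => z /=; exact: rV_consK.
Qed.

HB.instance Definition _ := Measure_isSigmaFinite.Build _ _ _ lebesgue_rV_succ
  sigma_finite_lebesgue_rV_succ.

End lebesgue_step.

(* Lebesgue measure on R^n: iterated product of the Lebesgue measure on R. *)
Fixpoint lebesgue_rV {R : realType} (n : nat) :
    {sigma_finite_measure set 'rV[R]_n -> \bar R} :=
  if n is k.+1 then lebesgue_rV_succ (lebesgue_rV k) else \d_(0 : 'rV[R]_0).

Section euclidean_geometry.
Context {R : realType}.

Definition dot {n} (x y : 'rV[R]_n) : R := \sum_(i < n) x 0 i * y 0 i.

Definition enorm {n} (x : 'rV[R]_n) : R := Num.sqrt (dot x x).

Definition frontier {n} (A : set 'rV[R]_n) : set 'rV[R]_n :=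
  closure A `\` interior A.

Definition bounded_domain {n} (A : set 'rV[R]_n) : Prop :=
  [/\ A !=set0, open A, connected A & bounded_set A].

(* [0] is included so that the diameter of the empty set is 0. *)
Definition diameter {n} (A : set 'rV[R]_n) : \bar R :=
  ereal_sup ([set (enorm (xy.1 - xy.2))%:E | xy in A `*` A] `|` [set 0%E]).

(* Volume of the unit ball of R^s over 2^s: with this factor the [s]-dimensional
   Hausdorff measure is the usual length (s = 1) and area (s = 2). *)
Definition hausdorff_factor (s : nat) : R :=
  fine (lebesgue_rV s [set x | enorm x <= 1]) / 2 ^+ s.

(* For [s = 0] the convention [0 ^+ 0 = 1] would charge the empty set;
   only [s = 1] and [s = 2] are used. *)
Definition hausdorff_content (s : nat) {n} (delta : R) (A : set 'rV[R]_n) :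
    \bar R :=
  ereal_inf [set t | exists U : nat -> set 'rV[R]_n,
    [/\ A `<=` \bigcup_i U i, forall i, (diameter (U i) <= delta%:E)%E &
        t = (\sum_(0 <= i <oo)
              (hausdorff_factor s * fine (diameter (U i)) ^+ s)%:E)%E]].

Definition hausdorff_measure (s : nat) {n} (A : set 'rV[R]_n) : \bar R :=
  ereal_sup [set hausdorff_content s delta A | delta in [set r | 0 < r]].

(* Boolean algebra of sets generated by the closed half-spaces. *)
Inductive polyhedral {n} : set 'rV[R]_n -> Prop :=
| polyhedral_half_space a b : polyhedral [set x | dot a x <= b]
| polyhedral_setC A : polyhedral A -> polyhedral (~` A)
| polyhedral_setU A B : polyhedral A -> polyhedral B -> polyhedral (A `|` B).

Definition is_cell {n} (K : set 'rV[R]_n) : Prop :=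
  [/\ K !=set0, open K & polyhedral K].

Definition hyperplane {n} (a : 'rV[R]_n) (b : R) : set 'rV[R]_n :=
  [set x | dot a x = b].

(* Interior, relative to the hyperplane, of its intersection with the
   boundary of [K]. *)
Definition flat_boundary {n} (K : set 'rV[R]_n) (a : 'rV[R]_n) (b : R) :
    set 'rV[R]_n :=
  [set x | hyperplane a b x /\
    exists2 U, nbhs x U & U `&` hyperplane a b `<=` frontier K].

(* Polyhedra need not be convex: the faces of [K] are its maximal connected
   flat pieces of boundary. *)
Definition is_face {n} (K e : set 'rV[R]_n) : Prop :=
  exists a b x, [/\ a != 0, flat_boundary K a b x &
    e = closure (connected_component (flat_boundary K a b) x)].

End euclidean_geometry.

Section mesh.
Context {R : realType} {d : nat}.
Implicit Types (Omega K e : set 'rV[R]_d).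

(* [e = K1|K2] *)
Definition is_interface e K1 K2 : Prop :=
  [/\ K1 <> K2, e = closure K1 `&` closure K2 & hausdorff_measure d.-1 e != 0%E].

Definition boundary_faces Omega (Th : {fset set 'rV[R]_d}) :
    set (set 'rV[R]_d) :=
  [set e | exists2 K, K \in Th & is_face K e /\ e `<=` frontier Omega].

Definition internal_faces (Th : {fset set 'rV[R]_d}) : set (set 'rV[R]_d) :=
  [set e | exists K1 K2, [/\ K1 \in Th, K2 \in Th & is_interface e K1 K2]].

(* [faces] is determined by [cells] through [mesh_faces]; it is recorded only to
   be available as a finite type. *)
Record mesh Omega := Mesh {
  cells : {fset set 'rV[R]_d};
  faces : {fset set 'rV[R]_d};
  mesh_cell : forall K, K \in cells -> is_cell K;
  mesh_cover : \bigcup_(K in [set` cells]) closure K = closure Omega;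
  mesh_disjoint : forall K1 K2, K1 \in cells -> K2 \in cells ->
    K1 `&` K2 = set0 \/ K1 = K2;
  mesh_faces : [set` faces] =
    boundary_faces Omega cells `|` internal_faces cells;
  mesh_boundary_cover :
    \bigcup_(e in boundary_faces Omega cells) e = frontier Omega;
  mesh_boundary_cell : forall e, boundary_faces Omega cells e ->
    exists! K, K \in cells /\ e `<=` closure K `&` frontier Omega;
  mesh_interface_unique : forall e K1 K2 K1' K2',
    K1 \in cells -> K2 \in cells -> K1' \in cells -> K2' \in cells ->
    is_interface e K1 K2 -> is_interface e K1' K2' ->
    (K1' = K1 /\ K2' = K2) \/ (K1' = K2 /\ K2' = K1);
  mesh_faces_cover :
    \bigcup_(e in [set` faces]) e = \bigcup_(K in [set` cells]) frontier K;
  mesh_faces_overlap : forall e e', e \in faces -> e' \in faces -> e <> e' ->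
    hausdorff_measure d.-1 (e `&` e') = 0%E
}.

End mesh.

Section discrete_spaces.
Context {R : realType} {d : nat} {Omega : set 'rV[R]_d} (T : mesh Omega).

Definition P0 := {ffun cells T -> R}.
HB.instance Definition _ := GRing.Lmodule.on P0.

Definition P0_fun (u : P0) (x : 'rV[R]_d) : R :=
  \sum_(K : cells T) u K * \1_(\val K) x.

Definition local_face (K : cells T) :=
  {e : faces T | `[< \val e `<=` frontier (\val K) >]}.

(* The pairs [(K, e)] with [e] in the boundary of [K]. *)
Definition flux_index := {K : cells T & local_face K}.

Definition conservative : {pred {ffun flux_index -> R}} := fun p =>
  `[< forall (K1 K2 : cells T) (e1 : local_face K1) (e2 : local_face K2),
        \val e1 = \val e2 -> is_interface (\val (\val e1)) (\val K1) (\val K2) ->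
        p (Tagged local_face e1) + p (Tagged local_face e2) = 0 >].

Lemma conservative_submod : submod_closed conservative.
Proof.
split=> [|a p q /asboolP pP /asboolP qP]; apply/asboolP => K1 K2 e1 e2 e12 eK.
  by rewrite !ffunE addr0.
rewrite !ffunE addrACA -mulrDr (pP K1 K2) // (qP K1 K2) //.
by rewrite mulr0 addr0.
Qed.

HB.instance Definition _ :=
  GRing.isSubmodClosed.Build R {ffun flux_index -> R} conservative
    conservative_submod.

Record Xh := MkXh {
  fluxes :> {ffun flux_index -> R};
  _ : fluxes \in conservative
}.
HB.instance Definition _ := [isSub for fluxes].
HB.instance Definition _ := [Choice of Xh by <:].
HB.instance Definition _ := [SubChoice_isSubLmodule of Xh by <:].

(* All families on the faces of [K]: since a face is the interface of at most
   one pair of cells, each of them is the restriction of an element of [Xh]. *)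
Definition XhK (K : cells T) := {ffun local_face K -> R}.
HB.instance Definition _ K := GRing.Lmodule.on (XhK K).

Definition restrict_flux (K : cells T) (p : Xh) : XhK K :=
  [ffun e => p (Tagged local_face e)].

End discrete_spaces.

Section mimetic_operators.
Context {R : realType} {d : nat} {Omega : set 'rV[R]_d} (T : mesh Omega).

Definition L2_prod (D : set 'rV[R]_d) (g h : 'rV[R]_d -> R) : R :=
  \int[lebesgue_rV d]_(x in D) (g x * h x).

Definition P0_prod (u v : P0 T) : R := L2_prod Omega (P0_fun u) (P0_fun v).

Definition cell_volume (K : set 'rV[R]_d) : R := fine (lebesgue_rV d K).

Definition face_area (e : set 'rV[R]_d) : R := fine (hausdorff_measure d.-1 e).

Definition pi2 (f : 'rV[R]_d -> R) : P0 T :=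
  [ffun K => (cell_volume (\val K))^-1 *
             \int[lebesgue_rV d]_(x in \val K) f x].

Definition divh (p : Xh T) : P0 T :=
  [ffun K => (cell_volume (\val K))^-1 *
             \sum_(e : local_face K)
               p (Tagged (@local_face _ _ _ T) e) * face_area (\val (\val e))].

Variable ip : forall K : cells T, {dot (XhK K) for idfun}.

Definition Xh_prod (p q : Xh T) : R :=
  \sum_(K : cells T) ip K (restrict_flux K p) (restrict_flux K q).

(* Minus the adjoint of [divh]; it exists and is unique because [Xh T] is
   finite-dimensional and [Xh_prod] is a scalar product. *)
Definition flux_operator : P0 T -> Xh T :=
  xget (fun=> 0) [set F | linear F /\
    forall p u, Xh_prod p (F u) = - P0_prod (divh p) u].

Variable f : 'rV[R]_d -> R.

Definition mfd_operator (x : P0 T * Xh T) : P0 T * Xh T :=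
  (- divh x.2 - pi2 f, x.2 - flux_operator x.1).

Definition mfd_hamiltonian (x : P0 T * Xh T) : R :=
  Xh_prod x.2 (flux_operator x.1) - 2^-1 * Xh_prod x.2 x.2
  - P0_prod x.1 (pi2 f).

End mimetic_operators.

(* Classical partial derivatives; the operators and the functional are total,
   with the library's default values where a derivative or an integral does not
   exist. *)
Section continuous_problem.
Context {R : realType} {d : nat} (Omega : set 'rV[R]_d) (f : 'rV[R]_d -> R).

Definition gradient (u : 'rV[R]_d -> R^o) (x : 'rV[R]_d) : 'rV[R]_d :=
  \row_(i < d) 'D_(delta_mx 0 i) u x.

Definition divergence (p : 'rV[R]_d -> 'rV[R]_d) (x : 'rV[R]_d) : R^o :=
  \sum_(i < d) 'D_(delta_mx 0 i) (fun y => p y 0 i : R^o) x.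

Definition L2_vect_prod (p q : 'rV[R]_d -> 'rV[R]_d) : R :=
  \int[lebesgue_rV d]_(x in Omega) dot (p x) (q x).

Definition poisson_operator
    (x : ('rV[R]_d -> R^o) * ('rV[R]_d -> 'rV[R]_d)) :
    ('rV[R]_d -> R^o) * ('rV[R]_d -> 'rV[R]_d) :=
  (fun y => - divergence x.2 y - f y, fun y => x.2 y - gradient x.1 y).

Definition poisson_hamiltonian
    (x : ('rV[R]_d -> R^o) * ('rV[R]_d -> 'rV[R]_d)) : R :=
  L2_vect_prod x.2 (gradient x.1) - 2^-1 * L2_vect_prod x.2 x.2
  - L2_prod Omega f x.1.

End continuous_problem.

Definition has_differential {R : realType} {X : lmodType R} (H : X -> R)
    (x y : X) (l : R) : Prop :=
  (fun eps : R => (H (x + eps *: y) - H x) / eps) @ 0^' --> l.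

Definition extremal {R : realType} {X : lmodType R} (H : X -> R) (x : X) : Prop :=
  forall y, has_differential H x y 0.

(* What is needed to interpret the expressions in which the mixed problem and
   its Hamiltonian are written.  A discrete embedding of an operator or of a
   functional is obtained by interpreting one and the same expression first in
   the continuous calculus and then in the discrete one. *)
Record calculus (R : realType) := Calculus {
  scal : lmodType R;
  vect : lmodType R;
  grad : scal -> vect;
  div : vect -> scal;
  source : scal;
  scal_prod : scal -> scal -> R;
  vect_prod : vect -> vect -> R
}.

Inductive scal_expr :=
| Unknown_u
| Source
| Div of vect_expr
| Scal_opp of scal_expr
| Scal_add of scal_expr & scal_expr
with vect_expr :=
| Unknown_p
| Grad of scal_expr
| Vect_opp of vect_expr
| Vect_add of vect_expr & vect_expr.

Inductive functional_expr (R : realType) :=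
| Scal_prod of scal_expr & scal_expr
| Vect_prod of vect_expr & vect_expr
| Functional_scale of R & functional_expr R
| Functional_add of functional_expr R & functional_expr R.

Section embedding.
Context {R : realType}.

Section interpretation.
Variables (C : calculus R) (x : scal C * vect C).

Fixpoint scal_eval (s : scal_expr) : scal C :=
  match s with
  | Unknown_u => x.1
  | Source => source C
  | Div v => div (vect_eval v)
  | Scal_opp s1 => - scal_eval s1
  | Scal_add s1 s2 => scal_eval s1 + scal_eval s2
  end
with vect_eval (v : vect_expr) : vect C :=
  match v with
  | Unknown_p => x.2
  | Grad s => grad (scal_eval s)
  | Vect_opp v1 => - vect_eval v1
  | Vect_add v1 v2 => vect_eval v1 + vect_eval v2
  end.

Fixpoint functional_eval (E : functional_expr R) : R :=
  match E with
  | Scal_prod s1 s2 => scal_prod (scal_eval s1) (scal_eval s2)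
  | Vect_prod v1 v2 => vect_prod (vect_eval v1) (vect_eval v2)
  | Functional_scale a E1 => a * functional_eval E1
  | Functional_add E1 E2 => functional_eval E1 + functional_eval E2
  end.

End interpretation.

Variables C Ch : calculus R.

Definition differential_embedding (P : scal C * vect C -> scal C * vect C)
    (Ph : scal Ch * vect Ch -> scal Ch * vect Ch) : Prop :=
  exists s v,
    (forall x, P x = (scal_eval x s, vect_eval x v)) /\
    (forall x, Ph x = (scal_eval x s, vect_eval x v)).

Definition variational_embedding (H : scal C * vect C -> R)
    (Hh : scal Ch * vect Ch -> R) : Prop :=
  exists E, (forall x, H x = functional_eval x E) /\
            (forall x, Hh x = functional_eval x E).

Definition coherent (P : scal C * vect C -> scal C * vect C)
    (H : scal C * vect C -> R)
    (Ph : scal Ch * vect Ch -> scal Ch * vect Ch) : Prop :=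
  differential_embedding P Ph /\
  exists2 Hh, variational_embedding H Hh &
    forall x, Ph x = 0 <-> extremal Hh x.

End embedding.

Definition poisson_calculus {R : realType} {d : nat} (Omega : set 'rV[R]_d)
    (f : 'rV[R]_d -> R) : calculus R :=
  @Calculus R ('rV[R]_d -> R^o) ('rV[R]_d -> 'rV[R]_d) gradient divergence f
    (L2_prod Omega) (L2_vect_prod Omega).

Definition mfd_calculus {R : realType} {d : nat} {Omega : set 'rV[R]_d}
    (T : mesh Omega) (ip : forall K : cells T, {dot (XhK K) for idfun})
    (f : 'rV[R]_d -> R) : calculus R :=
  @Calculus R (P0 T) (Xh T) (flux_operator ip) (@divh _ _ _ T) (pi2 T f)
    (@P0_prod _ _ _ T) (Xh_prod ip).

(* Main.v *)
(* Along [(v, q)] the discrete Hamiltonian is a quadratic polynomial, and since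
   the flux operator [F] is minus the adjoint of the divergence the linear
   coefficient at [(u, p)] is [[q, F u - p] - (v, div p + pi2 f)].  Testing with
   [(v, 0)] and [(0, q)] gives the discrete mixed problem because both scalar
   products are definite.  On cellwise constant functions the [L^2] product is a
   weighted sum with the positive weights [|K `&` Omega|].  The flux operator
   exists by Riesz representation on the finite-dimensional flux space. *)
From HB Require Import structures.
Require Import Defs.
From mathcomp Require Import all_boot all_order all_algebra.
From mathcomp Require Import finmap.
From mathcomp Require Import all_classical all_reals all_analysis.
From mathcomp Require Import measurable_realfun ring.

Set Implicit Arguments.
Unset Strict Implicit.
Unset Printing Implicit Defensive.
Import Order.TTheory GRing.Theory Num.Theory.
Import numFieldNormedType.Exports.
Local Open Scope classical_set_scope.
Local Open Scope ring_scope.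

(** * Scalar products and Riesz representation *)

Section dot_product.
Context {R : realFieldType} {V : lmodType R} (form : {dot V for idfun}).

Lemma dotC u v : form u v = form v u.
Proof. by rewrite hermC expr0 mul1r. Qed.

Lemma dotPr w a u v : form w (a *: u + v) = a * form w u + form w v.
Proof. exact: linearPr. Qed.

Lemma dotPl w a u v : form (a *: u + v) w = a * form u w + form v w.
Proof. by rewrite dotC dotPr !(dotC w). Qed.

Lemma dot0r w : form w 0 = 0. Proof. exact: linear0r. Qed.

Lemma dot0l w : form 0 w = 0. Proof. by rewrite dotC dot0r. Qed.

Lemma dotBl w u v : form (u - v) w = form u w - form v w.
Proof. exact: linearBl. Qed.

Lemma dotZl w a u : form (a *: u) w = a * form u w.
Proof. by rewrite -[a *: u]addr0 dotPl dot0l addr0. Qed.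

Lemma dotZr w a u : form w (a *: u) = a * form w u.
Proof. by rewrite dotC dotZl dotC. Qed.

Lemma dot_suml w I (r : seq I) (u : I -> V) :
  form (\sum_(i <- r) u i) w = \sum_(i <- r) form (u i) w.
Proof.
elim/big_rec2: _ => [|i a b _ <-]; first exact: dot0l.
by rewrite -[u i]scale1r dotPl mul1r scale1r.
Qed.

(** Definiteness tested at [w = u - v]; this gives uniqueness of Riesz representatives. *)
Lemma dot_inj u v : (forall w, form w u = form w v) -> u = v.
Proof.
move=> uv; apply/eqP; rewrite -subr_eq0; apply/negPn/negP => uv0.
have := @neq0_dnorm_gt0 _ _ _ form _ uv0.
by rewrite dotBl !(dotC _ (u - v)) uv subrr ltxx.
Qed.

End dot_product.

Section riesz.
Context {R : rcfType} {V : lmodType R} (form : {dot V for idfun}).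

Let orthonormal_family k (e : 'I_k -> V) :=
  forall i j, form (e i) (e j) = (i == j)%:R.

Let dot_orthonormal_suml k (e : 'I_k -> V) (x : 'I_k -> R) j :
  orthonormal_family e -> form (\sum_i x i *: e i) (e j) = x j.
Proof.
move=> oe; rewrite dot_suml (bigD1 j) //= big1 => [|i ij].
  by rewrite dotZl oe eqxx mulr1 addr0.
by rewrite dotZl oe (negPf ij) mulr0.
Qed.

Let orthonormal_extend k (e : 'I_k -> V) q : orthonormal_family e ->
  q != 0 -> (forall j, form q (e j) = 0) ->
  exists e' : 'I_k.+1 -> V, orthonormal_family e'.
Proof.
move=> oe q0 qe; have qq := @neq0_dnorm_gt0 _ _ _ form _ q0.
pose a := (Num.sqrt (form q q))^-1.
have aqq : a * (a * form q q) = 1.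
  by rewrite mulrA -expr2 exprVn sqr_sqrtr ?ltW// mulVf// gt_eqF.
exists (fun i => if unlift ord0 i is Some j then e j else a *: q) => i j.
case: unliftP => [i'|] ->; case: unliftP => [j'|] ->.
- by rewrite oe (inj_eq lift_inj).
- by rewrite dotZr dotC qe mulr0 eq_sym (negPf (neq_lift _ _)).
- by rewrite dotZl qe mulr0 (negPf (neq_lift _ _)).
- by rewrite dotZl dotZr eqxx.
Qed.

(* A maximal orthonormal family [e] spans [V], and the representative is
   [\sum_i l (e i) *: e i]. *)
Lemma riesz_representation n (phi : {linear V -> 'rV[R]_n}) (l : {scalar V}) :
  injective phi -> exists w, forall p, form p w = l p.
Proof.
move=> phi_inj.
pose P k := `[< exists e : 'I_k -> V, orthonormal_family e >].
have exP : exists k, P k.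
  by exists 0; apply/asboolP; exists (fun=> 0) => -[].
(* The images under [phi] of an orthonormal family are independent, since pairing a relation with
   [e j] isolates its coefficient [j]. Thus [phi] bounds the dimension. *)
have Ple k : P k -> (k <= n)%N.
  move=> /asboolP[e oe]; pose A : 'M[R]_(k, n) := \matrix_i phi (e i).
  suff /eqP <- : row_free A by exact: rank_leq_col.
  apply: inj_row_free => v; rewrite mulmx_sum_row.
  under eq_bigr do rewrite rowK -linearZ.
  rewrite -linear_sum => /= /eqP.
  rewrite -(linear0 phi) (inj_eq phi_inj) => /eqP v0.
  apply/rowP => j; rewrite mxE -[LHS](dot_orthonormal_suml (v 0) j oe).
  by rewrite v0 dot0l.
have [k /asboolP[e oe] kmax] := ex_maxnP exP Ple.
(* A non-zero residue would be orthogonal to [e] and extend it beyond the maximal size. *)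
have expand p : p = \sum_i form p (e i) *: e i.
  apply/eqP; rewrite -subr_eq0; apply/negPn/negP => q0.
  have [|e' oe'] := @orthonormal_extend k e _ oe q0.
    by move=> j; rewrite dotBl dot_orthonormal_suml// subrr.
  suff : (k.+1 <= k)%N by rewrite ltnn.
  by apply: kmax; apply/asboolP; exists e'.
exists (\sum_i l (e i) *: e i) => p.
rewrite dotC dot_suml [in RHS](expand p) linear_sum; apply: eq_bigr => i _.
by rewrite dotZl linearZ /= mulrC dotC.
Qed.

End riesz.

(** * Lebesgue measure of open sets, cubes and bounded sets *)

Lemma open_rV_measurable (R : realType) n (U : set 'rV[R]_n) :
  open U -> measurable U.
Proof.
move=> oU.
(* Rational cubes are finite intersections of coordinate preimages. Those not inside [U] are
   replaced by the empty set, so that the union runs over a whole countable type. *)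
pose box (z : 'rV[rat]_n * nat) : set 'rV[R]_n :=
  \bigcap_(i in [set: 'I_n])
    [set y | ball (ratr (z.1 0 i) : R) (z.2.+1%:R^-1) (y 0 i)].
have -> : U = \bigcup_(z : 'rV[rat]_n * nat)
    (if `[< box z `<=` U >] then box z else set0).
  apply/seteqP; split=> [x Ux|x [z _]]; last by case: asboolP => // zU /zU.
  have [e e0 xeU] : exists2 e : R, 0 < e & ball x e `<=` U.
    by have /nbhs_ballP[e e0 xe] := open_nbhs_nbhs (conj oU Ux); exists e.
  (* With radius [r < e / 2], a cube whose centre is within [r] of [x] contains [x] and stays within
     [r + r < e] of it. *)
  have /ltr_add_invr[k] : 0 < e / 2 by rewrite divr_gt0.
  rewrite add0r => ke; set r := k.+1%:R^-1 in ke.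
  have r0 : 0 < r by rewrite invr_gt0.
  have /choice[q qP] i : exists q : rat, ball (x 0 i) r (ratr q : R).
    have [q] : exists q, ratr q \in `](x 0 i - r), (x 0 i + r)[.
      by apply: rat_in_itvoo; rewrite ltrBlDr -addrA ltrDl addr_gt0.
    by exists q; rewrite ball_itv.
  exists (\row_i q i, k) => //.
  rewrite asboolT => [i _ /=|y hy]; first by rewrite mxE; exact/ball_sym.
  apply: xeU; split=> // i j; rewrite ord1.
  have /ltW rre : r + r < e by rewrite (splitr e); exact: ltrD.
  apply: le_ball rre _ _.
  by apply: ball_triangle (qP j) _; have := hy j I; rewrite /= mxE.
apply: countable_bigcupT_measurable => [|z]; first exact: countableP.
case: asboolP => _; last exact: measurable0.
apply: fin_bigcap_measurable => // i _.
rewrite -[X in measurable X]setTI.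
apply: (measurable_coord i) => //; rewrite ball_itv; exact: measurable_itv.
Qed.

(** Balls of row vectors are those of the sup norm, hence cubes of side [e *+ 2]. Each induction
    step splits off one interval through [rV_cons]; for [n = 0] the Dirac mass gives 1. *)
Lemma lebesgue_rV_ball (R : realType) n (x : 'rV[R]_n) (e : R) : 0 < e ->
  measurable (ball x e) /\ lebesgue_rV n (ball x e) = ((e *+ 2) ^+ n)%:E.
Proof.
move=> e0; split; first by apply: open_rV_measurable; apply: ball_open.
elim: n x => [|n IH] x.
  rewrite /= diracE mem_set // thinmx0. exact: ballxx.
rewrite /= /lebesgue_rV_succ /pushforward.
have -> : @rV_cons R n @^-1` ball x e =
    ball (x 0 ord0) e `*` ball (\row_j x 0 (lift ord0 j)) e.
  apply/seteqP; split=> [[a v] [_ /= h]|[a v] [/= ha [_ hv]]].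
    split=> /=; first by have := h 0 ord0; rewrite mxE unlift_none.
    split=> // i j; rewrite ord1 mxE.
    by have := h 0 (lift ord0 j); rewrite mxE liftK.
  split=> // i j; rewrite ord1 mxE; case: unliftP => [k|] -> //=.
  by have := hv 0 k; rewrite mxE.
rewrite product_measure1E ?IH//.
- rewrite exprS EFinM; congr (_ * _)%E.
  exact/lebesgue_measure_ball/ltW.
- by rewrite ball_itv; exact: measurable_itv.
- by apply: open_rV_measurable; apply: ball_open.
Qed.

Lemma open_lebesgue_rV_gt0 (R : realType) n (U : set 'rV[R]_n) :
  open U -> U !=set0 -> (0 < lebesgue_rV n U)%E.
Proof.
move=> oU [x Ux].
have /nbhs_ballP[e /= e0 xeU] := open_nbhs_nbhs (conj oU Ux).
have [mB lB] := lebesgue_rV_ball x e0.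
apply: (@lt_le_trans _ _ (lebesgue_rV n (ball x e))).
  by rewrite lB lte_fin exprn_gt0// pmulrn_lgt0.
by apply: le_measure => //; rewrite inE//; exact: open_rV_measurable.
Qed.

Lemma bounded_lebesgue_rV_lty (R : realType) n (A : set 'rV[R]_n) :
  measurable A -> bounded_set A -> (lebesgue_rV n A < +oo)%E.
Proof.
move=> mA [M [_ AM]].
(* [bounded_set] bounds the norm only by numbers strictly above [M], whence one unit; the other
   makes the ball inequality strict. The maximum keeps the radius positive. *)
pose e : R := Num.max M 0 + 2.
have e0 : 0 < e by rewrite ltr_wpDl// le_max lexx orbT.
have [mB lB] := lebesgue_rV_ball (0 : 'rV[R]_n) e0.
apply: (@le_lt_trans _ _ (lebesgue_rV n (ball 0 e))); last by rewrite lB ltry.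
apply: le_measure; rewrite ?inE// => x Ax.
have xM : `|x| <= Num.max M 0 + 1.
  by apply: (AM (Num.max M 0 + 1)) => //; rewrite ltr_pwDr// le_max lexx.
rewrite mx_norm_ball /ball_ /= sub0r normrN (le_lt_trans xM)//.
by rewrite ltrD2l ltr1n.
Qed.

(** * The product on cellwise constant functions as a weighted sum *)

Section P0_product.
Context {R : realType} {d : nat} {Omega : set 'rV[R]_d}.
Context (hOmega : bounded_domain Omega) (T : mesh Omega).

Let lambda := @lebesgue_rV R d.

Let open_Omega : open Omega. Proof. by case: hOmega. Qed.

Let open_cell (K : cells T) : open (\val K).
Proof. by have [] := mesh_cell (valP K). Qed.

Let measurable_cell (K : cells T) : measurable (\val K).
Proof. exact: open_rV_measurable. Qed.

Let measurable_Omega : measurable Omega.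
Proof. exact: open_rV_measurable. Qed.

(** Cut by [Omega], the domain of integration in [P0_prod]; finite because [Omega] is bounded, so
    [fine] loses nothing. *)
Definition cell_weight (K : cells T) : R := fine (lambda (\val K `&` Omega)).

Let cell_lty (K : cells T) : (lambda (\val K `&` Omega) < +oo)%E.
Proof.
apply: (@le_lt_trans _ _ (lambda Omega)).
  by apply: le_measure; rewrite ?inE//; exact: measurableI.
by apply: bounded_lebesgue_rV_lty => //; case: hOmega.
Qed.

(* A cell may stick out of [Omega], but being open and contained in the closure
   of [Omega] it meets [Omega]. *)
Lemma cell_weight_gt0 K : 0 < cell_weight K.
Proof.
apply: fine_gt0; rewrite cell_lty andbT.
apply: open_lebesgue_rV_gt0; first exact: openI.
have [[x Kx] _ _] := mesh_cell (valP K).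
have : closure Omega x.
  rewrite -(mesh_cover T); exists (\val K); first exact: valP.
  exact: subset_closure.
move=> /(_ (\val K)) KO; rewrite setIC; apply: KO.
apply: open_nbhs_nbhs; split=> //; exact: open_cell.
Qed.

(** Cells are disjoint, so at most one indicator is non-zero at [x] and no cross terms survive. *)
Lemma P0_fun_mul (u v : P0 T) x :
  P0_fun u x * P0_fun v x = \sum_(K : cells T) u K * v K * \1_(\val K) x.
Proof.
have [[K Kx]|noK] := pselect (exists K : cells T, (\val K) x); last first.
  have K0 (K : cells T) : \1_(\val K) x = 0 :> R.
    by rewrite indicE memNset// => Kx; apply: noK; exists K.
  by rewrite /P0_fun !big1 ?mulr0// => K _; rewrite K0 mulr0.
have K'0 (K' : cells T) : K' != K -> \1_(\val K') x = 0 :> R.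
  move=> K'K; rewrite indicE memNset// => K'x.
  have [K'IK|/val_inj K'eK] := mesh_disjoint (valP K') (valP K).
    by have : (\val K' `&` \val K) x by []; rewrite K'IK.
  by rewrite K'eK eqxx in K'K.
have one w : \sum_(K' : cells T) w K' * \1_(\val K') x = w K :> R.
  rewrite (bigD1 K)//= indicE mem_set// mulr1 big1 ?addr0// => K' K'K.
  by rewrite K'0 ?mulr0.
by rewrite /P0_fun !one.
Qed.

(** Reduces linearity and definiteness of [P0_prod] to finite sums. Integrability of the indicators
    lets sum and integral be exchanged. *)
Lemma P0_prodE (u v : P0 T) :
  P0_prod u v = \sum_(K : cells T) u K * v K * cell_weight K.
Proof.
have int_cell (K : cells T) :
    lambda.-integrable Omega (fun x => (\1_(\val K) x)%:E).
  apply/integrableP; split.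
    by apply/measurable_EFinP; exact: measurable_indic.
  under eq_integral do rewrite gee0_abs ?lee_fin//.
  rewrite integral_indic//; exact: cell_lty.
rewrite /P0_prod /L2_prod /Rintegral.
under eq_integral do rewrite P0_fun_mul -sumEFin.
rewrite integral_sum// => [|K]; last first.
  under eq_fun do rewrite EFinM.
  exact: integrableZl.
rewrite (eq_bigr (fun K => (u K * v K * cell_weight K)%:E)) ?sumEFin// => K _.
under eq_integral do rewrite EFinM.
rewrite integralZl// integral_indic// [in RHS]EFinM /cell_weight fineK//.
by rewrite ge0_fin_numE//; exact: cell_lty.
Qed.

End P0_product.

(** Away from [eps = 0] the difference quotient is [a + eps * b], which tends to [a]; limits are
    unique. Extremality thereby becomes an algebraic condition. *)
Lemma has_differential_quadratic (R : realType) (X : lmodType R) (H : X -> R)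
    x y a b l :
  (forall eps, H (x + eps *: y) = H x + eps * a + eps ^+ 2 * b) ->
  has_differential H x y l <-> a = l.
Proof.
move=> Heps.
have cvg_a : has_differential H x y a.
  rewrite /has_differential.
  have : (fun eps : R => a + eps * b) @ 0^' --> a.
    rewrite -[X in _ --> X]addr0 -[X in _ + X](mul0r b).
    apply: cvgD; first exact: cvg_cst.
    by apply: cvgMl; exact: nbhs_dnbhs.
  apply: cvg_trans; apply: near_eq_cvg; near=> eps.
  have eps0 : eps != 0 by near: eps; exact: nbhs_dnbhs_neq.
  rewrite Heps -(addrA (H x)) (addrC _ (- H x)) addKr expr2.
  by rewrite -mulrA -mulrDr mulrAC divff// mul1r.
split=> [|<-//]; exact: cvg_unique cvg_a.
Unshelve. all: by end_near. Qed.

(** * Existence of the flux operator and equivalence of the two formulations *)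

Section flux_operator.
Context {R : realType} {d : nat} {Omega : set 'rV[R]_d} (T : mesh Omega).
Context (ip : forall K : cells T, {dot (XhK K) for idfun}).

Let restrict_fluxP (K : cells T) a p q :
  restrict_flux K (a *: p + q) = a *: restrict_flux K p + restrict_flux K q.
Proof. by apply/ffunP => e; rewrite !ffunE. Qed.

Let Xh_prodC p q : Xh_prod ip p q = Xh_prod ip q p.
Proof. by apply: eq_bigr => K _; exact: dotC. Qed.

Let Xh_prodPr w a p q :
  Xh_prod ip w (a *: p + q) = a * Xh_prod ip w p + Xh_prod ip w q.
Proof.
rewrite mulr_sumr -big_split; apply: eq_bigr => K _ /=.
by rewrite restrict_fluxP dotPr.
Qed.

(** This and the next instances make [Xh_prod ip] a scalar product to which [dot_inj] and
    [riesz_representation] apply. *)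
Let Xh_prod_bilinear :
  bilinear_for ( *%R ) (idfun \; *%R) (Xh_prod ip).
Proof.
split=> [w|w] a p q; last exact: Xh_prodPr.
by rewrite !(Xh_prodC _ w) Xh_prodPr.
Qed.

HB.instance Definition _ :=
  bilinear_isBilinear.Build R (Xh T) (Xh T) R ( *%R ) (idfun \; *%R)
    (Xh_prod ip) Xh_prod_bilinear.

Let Xh_prod_hermitian p q :
  Xh_prod ip p q = (-1) ^+ false * idfun (Xh_prod ip q p).
Proof. by rewrite mul1r Xh_prodC. Qed.

HB.instance Definition _ :=
  isHermitianSesquilinear.Build R (Xh T) false idfun (Xh_prod ip)
    Xh_prod_hermitian.

(** If the sum of non-negative local terms vanishes, so does every restriction, and the restrictions
    cover all pairs [(K, e)]. *)
Let Xh_prod_gt0 p : p != 0 -> 0 < Xh_prod ip p p.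
Proof.
have ip_ge0 (K : cells T) (q : XhK K) : 0 <= ip K q q.
  have [->|/(@neq0_dnorm_gt0 _ _ _ (ip K))/ltW//] := eqVneq q 0.
  by rewrite dot0r.
move=> p0; rewrite lt_neqAle sumr_ge0// andbT eq_sym; apply: contra p0.
rewrite psumr_eq0// => /allP pp0; apply/eqP/val_inj/ffunP => -[K e].
have : ip K (restrict_flux K p) (restrict_flux K p) == 0.
  by apply: pp0; rewrite mem_index_enum.
have [/ffunP/(_ e) + _|/(@neq0_dnorm_gt0 _ _ _ (ip K))] :=
  eqVneq (restrict_flux K p) 0; first by rewrite !ffunE.
by move=> /gt_eqF ->.
Qed.
HB.instance Definition _ :=
  isDotProduct.Build R (Xh T) (Xh_prod ip) Xh_prod_gt0.

(** Coordinates on all pairs [(K, e)]: the injective linear map required by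
    [riesz_representation]. *)
Let flux_row (p : Xh T) : 'rV[R]_#|{: flux_index T}| := \row_i p (enum_val i).

Let flux_row_linear : linear flux_row.
Proof. by move=> a p q; apply/rowP => i; rewrite !mxE !ffunE. Qed.

HB.instance Definition _ :=
  GRing.isLinear.Build R (Xh T) 'rV[R]_#|{: flux_index T}| _
    flux_row flux_row_linear.

Let flux_row_inj : injective flux_row.
Proof.
move=> p q pq; apply/val_inj/ffunP => i.
by have /rowP/(_ (enum_rank i)) := pq; rewrite !mxE enum_rankK.
Qed.

Let P0_prodC (u v : P0 T) : P0_prod u v = P0_prod v u.
Proof. by rewrite /P0_prod /L2_prod; under eq_Rintegral do rewrite mulrC. Qed.

Context (hOmega : bounded_domain Omega).

Let P0_prodPl (w : P0 T) a u v :
  P0_prod (a *: u + v) w = a * P0_prod u w + P0_prod v w.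
Proof.
rewrite !P0_prodE// mulr_sumr -big_split; apply: eq_bigr => K _ /=.
by rewrite !ffunE [a *: _]/(_ * _) !mulrDl !mulrA.
Qed.

Let P0_prod0l (w : P0 T) : P0_prod 0 w = 0.
Proof. by rewrite P0_prodE// big1// => K _; rewrite ffunE !mul0r. Qed.

Lemma P0_prod_eq0 (u : P0 T) : P0_prod u u = 0 -> u = 0.
Proof.
rewrite P0_prodE// => /eqP; rewrite psumr_eq0 => [/allP uu0|K _]; last first.
  by rewrite -expr2 mulr_ge0 ?sqr_ge0// ltW// cell_weight_gt0.
apply/ffunP => K; rewrite ffunE; apply/eqP.
have := uu0 K (mem_index_enum _).
by rewrite !mulf_eq0 orbb (gt_eqF (cell_weight_gt0 hOmega K)) orbF.
Qed.

Lemma divhP a (p q : Xh T) : divh (a *: p + q) = a *: divh p + divh q.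
Proof.
apply/ffunP => K; rewrite !ffunE -[RHS]/(a * _ + _) mulrCA -mulrDr.
congr (_ * _); rewrite mulr_sumr -big_split; apply: eq_bigr => e _ /=.
by rewrite !ffunE mulrDl mulrA.
Qed.

(** [xget] returns an element of the defining set once that set is inhabited. For each [u], Riesz
    represents the linear form [- P0_prod (divh p) u] in [p]. *)
Lemma flux_operatorP : linear (flux_operator ip) /\
  forall p u, Xh_prod ip p (flux_operator ip u) = - P0_prod (divh p) u.
Proof.
apply: (@xgetPex _ (fun=> 0) [set F | linear F /\
  forall p u, Xh_prod ip p (F u) = - P0_prod (divh p) u]).
have /choice[F FP] (u : P0 T) :
    exists w, forall p, Xh_prod ip p w = - P0_prod (divh p) u.
  pose l p := - P0_prod (divh p) u.
  have l_linear : scalar l.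
    by move=> a p q; rewrite /l divhP P0_prodPl opprD mulrN.
  pose lL := GRing.isLinear.Build R (Xh T) R _ l l_linear.
  pose L : {scalar Xh T} := HB.pack l lL.
  exact: (riesz_representation (Xh_prod ip) L flux_row_inj).
(* The pointwise chosen [F] is linear because representatives are unique. *)
exists F; split=> [a u v|p u]; last exact: FP.
apply: (dot_inj (form := Xh_prod ip)) => p.
rewrite [LHS]FP [RHS]Xh_prodPr !FP !(P0_prodC (divh p)) P0_prodPl.
by rewrite opprD mulrN.
Qed.

Let Xh_prodDZr w p a q :
  Xh_prod ip w (p + a *: q) = Xh_prod ip w p + a * Xh_prod ip w q.
Proof. by rewrite addrC Xh_prodPr addrC. Qed.

Let Xh_prodDZl w p a q :
  Xh_prod ip (p + a *: q) w = Xh_prod ip p w + a * Xh_prod ip q w.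
Proof. by rewrite !(Xh_prodC _ w) Xh_prodDZr. Qed.

Let P0_prodDZl (w : P0 T) u a v :
  P0_prod (u + a *: v) w = P0_prod u w + a * P0_prod v w.
Proof. by rewrite addrC P0_prodPl addrC. Qed.

Context (f : 'rV[R]_d -> R).

Lemma mfd_hamiltonian_differential (u v : P0 T) (p q : Xh T) :
  has_differential (mfd_hamiltonian ip f) (u, p) (v, q) 0 <->
  Xh_prod ip q (flux_operator ip u - p) = P0_prod v (divh p + pi2 T f).
Proof.
have [F_linear FP] := flux_operatorP.
set F := flux_operator ip in F_linear FP *.
have FDZ a : F (u + a *: v) = F u + a *: F v.
  by rewrite addrC F_linear addrC.
(* Coefficients of [eps] and [eps ^+ 2]. The adjoint relation turns [[p, F v]] into [-(div p, v)];
   by symmetry the two cross terms of [[p, p]] agree and absorb the factor one half. *)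
pose a := Xh_prod ip q (F u - p) - P0_prod v (divh p + pi2 T f).
pose b := Xh_prod ip q (F v) - 2^-1 * Xh_prod ip q q.
have Hab eps : mfd_hamiltonian ip f ((u, p) + eps *: (v, q)) =
    mfd_hamiltonian ip f (u, p) + eps * a + eps ^+ 2 * b.
  rewrite /mfd_hamiltonian /a /b /= -/F FDZ !Xh_prodDZl !Xh_prodDZr P0_prodDZl.
  rewrite -[- p]scaleN1r -[pi2 T f]scale1r Xh_prodDZr !(P0_prodC v) P0_prodDZl.
  rewrite scale1r (Xh_prodC q p) !FP (P0_prodC _ v).
  by field.
have Da := has_differential_quadratic 0 Hab.
split=> [/Da/eqP|qv]; first by rewrite subr_eq0 => /eqP.
by apply/Da; rewrite /a qv subrr.
Qed.

Lemma mfd_operator_eq0 (u : P0 T) (p : Xh T) :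
  mfd_operator ip f (u, p) = 0 <->
  forall v q, has_differential (mfd_hamiltonian ip f) (u, p) (v, q) 0.
Proof.
split=> [PH v q|Dup].
  have /= divp := congr1 fst PH; have /= /subr0_eq pF := congr1 snd PH.
  apply/mfd_hamiltonian_differential; rewrite -pF subrr.
  rewrite -[divh p + _]opprK opprD divp oppr0 P0_prodC.
  by rewrite P0_prod0l [LHS](dot0r (Xh_prod ip)).
have {}Dup v q := (mfd_hamiltonian_differential u v p q).1 (Dup v q).
have divp : divh p + pi2 T f = 0.
  (* The direction is the residual itself in the scalar component, with zero flux. *)
  by apply: P0_prod_eq0; rewrite -(Dup _ 0) [LHS](dot0l (Xh_prod ip)).
have Fp : flux_operator ip u - p = 0.
  apply: (dot_inj (form := Xh_prod ip)) => q.
  by rewrite [LHS](Dup 0 q) P0_prod0l [RHS]dot0r.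
congr pair; first by rewrite -opprD divp oppr0.
by rewrite -opprB Fp oppr0.
Qed.

End flux_operator.

Theorem theorem5 (R : realType) (d : nat) (hd : d = 2%N \/ d = 3%N)
    (Omega : set 'rV[R]_d) (hOmega : bounded_domain Omega) (T : mesh Omega)
    (f : 'rV[R]_d -> R) (hf : f \_ Omega \in Lfun (lebesgue_rV d) 2%:E)
    (ip : forall K : cells T, {dot (XhK K) for idfun}) :
  (forall (uh : P0 T) (ph : Xh T),
     mfd_operator ip f (uh, ph) = 0 <->
     (forall (vh : P0 T) (qh : Xh T),
        has_differential (mfd_hamiltonian ip f) (uh, ph) (vh, qh) 0)) /\
  @coherent R (poisson_calculus Omega f) (mfd_calculus ip f)
    (poisson_operator f) (poisson_hamiltonian Omega f) (mfd_operator ip f).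
Proof.
split=> [u p|]; first exact: mfd_operator_eq0.
split.
  (* Both operators are evaluations of [- div p - source] and [p - grad u], by computation. *)
  exists (Scal_add (Scal_opp (Div Unknown_p)) (Scal_opp Source)).
  exists (Vect_add Unknown_p (Vect_opp (Grad Unknown_u))).
  by split.
exists (mfd_hamiltonian ip f).
  exists (Functional_add
    (Functional_add (Vect_prod _ Unknown_p (Grad Unknown_u))
      (Functional_scale (- 2^-1) (Vect_prod _ Unknown_p Unknown_p)))
    (Functional_scale (- 1) (Scal_prod _ Source Unknown_u))).
  split=> x /=; first by rewrite !mulNr mul1r.
  (* The expression has the source first, as in the continuous functional, whereas [mfd_hamiltonian]
     has it second; the integrand is commuted. *)
  rewrite !mulNr mul1r /mfd_hamiltonian /P0_prod /L2_prod.
  by under [in RHS]eq_Rintegral do rewrite mulrC.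
move=> [u p]; have [PD DP] := mfd_operator_eq0 ip hOmega f u p.
by split=> [PH [v q]|DH]; [exact: PD | apply: DP => v q; exact: DH].
Qed.
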